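(* Let $T\ge 2$ be an integer and let $\mu>0$, $\sigma>0$, $-\frac{1}{T-1}<\rho<1$ satisfy $\mu^2+\rho\sigma^2>0$. Set $\theta=1+(T-1)\rho>0$. For $\gamma>0$ let $$\mathrm{R}'(\gamma)=\sup_{\mathbb P\in\mathcal P'}\mathbb P\Big(\prod_{t=1}^T\tilde\xi_t\ge\gamma\Big),$$ with the ambiguity set $\mathcal P'$ defined in the context. Then $$ \mathrm{R}'(\gamma)=\begin{cases} 1 & \text{if } 0<\gamma\le\mu^T,\\ \mu\gamma^{-1/T} & \text{if } \mu^T<\gamma<\left(\mu+\frac{\sigma^2\theta}{T\mu}\right)^T,\\ \dfrac{\sigma^2\theta}{\sigma^2\theta+T(\mu-\gamma^{1/T})^2} & \text{if } \gamma\ge\left(\mu+\frac{\sigma^2\theta}{T\mu}\right)^T. \end{cases} $$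
   Context: Let $\boldsymbol\mu=\mu\boldsymbol 1\in\mathbb R^T$ and $\boldsymbol\Sigma=(1-\rho)\sigma^2\mathbb I+\rho\sigma^2\boldsymbol 1\boldsymbol 1^\intercal$, where $\mathbb I$ is the $T\times T$ identity matrix and $\boldsymbol 1$ the all-ones vector. $\mathcal P'$ is the set of all Borel probability distributions $\mathbb P$ of a random vector $\tilde{\boldsymbol\xi}=(\tilde\xi_1,\dots,\tilde\xi_T)^\intercal$ supported on $\mathbb R^T_+$ with $\mathbb E_{\mathbb P}(\tilde{\boldsymbol\xi})=\boldsymbol\mu$ and $\mathbb E_{\mathbb P}(\tilde{\boldsymbol\xi}\tilde{\boldsymbol\xi}^\intercal)\preceq\boldsymbol\Sigma+\boldsymbol\mu\boldsymbol\mu^\intercal$, where $\boldsymbol A\preceq\boldsymbol B$ means that $\boldsymbol B-\boldsymbol A$ is positive semidefinite. *)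

(* Defs.v *)
From HB Require Import structures.
From mathcomp Require Import all_boot all_order all_algebra.
From mathcomp Require Import all_classical all_reals all_analysis.

Set Implicit Arguments.
Unset Strict Implicit.
Unset Printing Implicit Defensive.
Import Order.TTheory GRing.Theory Num.Theory.
Import numFieldNormedType.Exports.
Local Open Scope classical_set_scope.
Local Open Scope ring_scope.

Definition psdmx (R : realType) (T : nat) (A : 'M[R]_T) : Prop :=
  A^T = A /\ forall x : 'cV[R]_T, 0 <= (x^T *m A *m x) 0 0.

Definition loewner_le (R : realType) (T : nat) (A B : 'M[R]_T) : Prop :=
  psdmx (B - A).

Definition nonneg_orthant (R : realType) (T : nat) : set (T.-tuple R) :=
  [set x | forall t, 0 <= tnth x t].

(* Vectors of R^T are tuples: their sigma-algebra is the one generated by the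
   coordinate projections to the Borel line, i.e., the Borel sigma-algebra of
   R^T. *)
Section moments.
Variables (R : realType) (T : nat) (P : probability (T.-tuple R) R).

Definition has_mean (m : 'cV[R]_T) : Prop :=
  forall t : 'I_T,
    P.-integrable setT (fun x : T.-tuple R => (tnth x t)%:E) /\
    ('E_P[fun x : T.-tuple R => tnth x t] = (m t 0)%:E)%E.

Definition has_second_moments : Prop :=
  forall s t : 'I_T,
    P.-integrable setT (fun x : T.-tuple R => (tnth x s * tnth x t)%:E).

(* [fine] sends infinities to 0, so this matrix is meaningful only under
   [has_second_moments]. *)
Definition second_moment_mx : 'M[R]_T :=
  \matrix_(s, t) fine ('E_P[fun x : T.-tuple R => (tnth x s * tnth x t)%R])%E.

End moments.

(* The matrix inequality on the second moments is only stated together with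
   their finiteness, which it presupposes. *)
Definition ambiguity_set (R : realType) (T : nat)
    (m : 'cV[R]_T) (S : 'M[R]_T) : set (probability (T.-tuple R) R) :=
  [set P : probability (T.-tuple R) R |
    [/\ P (@nonneg_orthant R T) = 1%E, has_mean P m, has_second_moments P
      & loewner_le (second_moment_mx P) (S + m *m m^T)]].

Definition mean_vec (R : realType) (T : nat) (mu : R) : 'cV[R]_T :=
  mu *: const_mx 1.

Definition covariance_mx (R : realType) (T : nat) (sigma rho : R) : 'M[R]_T :=
  ((1 - rho) * sigma ^+ 2) *: 1%:M +
  (rho * sigma ^+ 2) *: ((const_mx 1 : 'cV[R]_T) *m (const_mx 1)^T).

Definition sup_prob_prod_ge (R : realType) (T : nat)
    (m : 'cV[R]_T) (S : 'M[R]_T) (gamma : R) : \bar R :=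
  ereal_sup [set P [set x : T.-tuple R | gamma <= \prod_(t < T) tnth x t]
            | P in ambiguity_set m S].

(* Main.v *)
(* By the AM-GM inequality the event forces the sample mean
   Y = (xi_1 + ... + xi_T) / T to be at least g = gamma ^ (1/T). Testing the
   moment constraints against the all-ones vector leaves E Y = mu and
   E Y^2 <= mu^2 + s with s = sigma^2 theta / T, so that any quadratic which
   dominates the indicator of [g, +oo[ on [0, +oo[ bounds the probability: the
   constant 1, Markov's y / g, or Cantelli's ((y - b) / (g - b))^2 with
   b = mu - s / (g - mu), which is nonnegative exactly in the last regime.
   Each bound is attained by a law on two multiples of the all-ones vector, at
   the points where the quadratic touches the indicator; it is in the ambiguity
   set because for matrices of the form a I + c 1 1^T semidefiniteness amounts
   to a >= 0 and a + T c >= 0. *)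

Require Import Defs.
From HB Require Import structures.
From mathcomp Require Import all_boot all_order all_algebra.
From mathcomp Require Import all_classical all_reals all_analysis.
From mathcomp Require Import ring lra.
From mathcomp Require Import measurable_realfun.
Set Implicit Arguments.
Unset Strict Implicit.
Unset Printing Implicit Defensive.
Import Order.TTheory GRing.Theory Num.Theory.
Import numFieldNormedType.Exports.
Local Open Scope classical_set_scope.
Local Open Scope ring_scope.

(** * Laws with two atoms *)

Definition bool_choice (U : Type) (a b : U) (c : bool) : U :=
  if c then a else b.

Lemma measurable_bool_choice d (U : measurableType d) (a b : U) :
  measurable_fun [set: bool] (bool_choice a b).
Proof. by []. Qed.

HB.instance Definition _ d (U : measurableType d) (a b : U) :=
  isMeasurableFun.Build _ _ _ _ (bool_choice a b)
    (measurable_bool_choice a b).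

(* Outside 0 <= p <= 1 this is the Dirac mass at b. *)
Definition two_point (R : realType) d (U : measurableType d) (p : R)
    (a b : U) : probability U R :=
  distribution (bernoulli_prob p) (bool_choice a b).

(** A function on [bool] is bounded, by the sum of its two absolute values. *)
Lemma integrable_bernoulli_prob (R : realType) (p : R) (f : bool -> R) :
  (bernoulli_prob p).-integrable setT (EFin \o f).
Proof.
apply: measurable_bounded_integrable => //.
  by rewrite /= probability_setT ltry.
exists (`|f true| + `|f false|); split; first exact: num_real.
move=> M ltM [] _ /=.
  by apply: ltW; apply: le_lt_trans ltM; rewrite lerDl.
by apply: ltW; apply: le_lt_trans ltM; rewrite lerDr.
Qed.

Section two_point_moments.
Context {R : realType} {d} {U : measurableType d} (p : R) (a b : U).
Hypothesis p01 : 0 <= p <= 1.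

Lemma two_point_integrable (f : U -> R) : measurable_fun setT f ->
  (two_point p a b).-integrable setT (EFin \o f).
Proof.
move=> mf; apply: integrable_pushforward => //.
  exact/measurable_EFinP.
exact: (integrable_bernoulli_prob p (f \o bool_choice a b)).
Qed.

Lemma two_point_integral (f : U -> R) : measurable_fun setT f ->
  0 <= f a -> 0 <= f b ->
  (\int[two_point p a b]_x (f x)%:E = (p * f a + (1 - p) * f b)%:E)%E.
Proof.
move=> mf fa fb; rewrite /two_point integral_distribution.
- rewrite integral_bernoulli_prob //.
  by case.
- exact/measurable_EFinP.
- exact: (integrable_bernoulli_prob p (f \o bool_choice a b)).
Qed.

Lemma two_point_measure (A : set U) : measurable A ->
  (two_point p a b A = (p * \1_A a + (1 - p) * \1_A b)%:E)%E.
Proof.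
move=> mA; rewrite -two_point_integral //.
by rewrite integral_indic // setIT.
Qed.
End two_point_moments.

(** * Bounding a probability by two moments *)

Section moment_bound.
Context {R : realType} {d} {U : measurableType d} (P : probability U R).
Variables (Y : U -> R) (O A : set U) (c0 c1 c2 m1 m2 : R).
Hypotheses (intY : P.-integrable setT (EFin \o Y))
  (intY2 : P.-integrable setT (fun x => (Y x ^+ 2)%:E))
  (EY : (\int[P]_x (Y x)%:E = m1%:E)%E)
  (EY2 : (\int[P]_x (Y x ^+ 2)%:E <= m2%:E)%E)
  (mO : measurable O) (mA : measurable A) (PO : P O = 1%E) (c2_ge0 : 0 <= c2).

(** Integrate the domination of the indicator by the quadratic. The mean is known exactly, so [c1]
    may have any sign; the second moment is only bounded above, whence [0 <= c2]. *)
Lemma prob_le_moments :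
  (forall x, O x -> \1_A x <= c0 + (c1 * Y x + c2 * Y x ^+ 2)) ->
  (P A <= (c0 + (c1 * m1 + c2 * m2))%:E)%E.
Proof.
move=> Aq.
have i0 : P.-integrable setT (fun=> c0%:E).
  exact: finite_measure_integrable_cst.
have i1 : P.-integrable setT (fun x => c1%:E * (Y x)%:E)%E.
  exact: integrableZl.
have i2 : P.-integrable setT (fun x => c2%:E * (Y x ^+ 2)%:E)%E.
  exact: integrableZl.
have i12 := integrableD measurableT i1 i2.
have iq := integrableD measurableT i0 i12.
have PO' : P (~` O) = 0%E by rewrite probability_setC // PO subee.
have le_q : (P A <=
    \int[P]_x (c0%:E + (c1%:E * (Y x)%:E + c2%:E * (Y x ^+ 2)%:E)))%E.
  (* The complement of [O] is null, so both integrals reduce to [O], where the domination is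
     assumed. *)
  rewrite (negligible_integral (measurableC mO) measurableT iq PO') setTD setCK.
  have iA : P.-integrable setT (EFin \o \1_A).
    exact: integrable_indic.
  rewrite -[A in P A]setIT -(integral_indic _ measurableT) //.
  rewrite (negligible_integral (measurableC mO) measurableT iA PO') setTD setCK.
  apply: le_integral => //.
  - exact: (integrableS measurableT).
  - exact: (integrableS measurableT).
  - by move=> x /set_mem Ox /=; rewrite lee_fin Aq.
apply: (le_trans le_q).
rewrite integralD // integralD // !integralZl // EY integral_cst //.
rewrite -[(c0%:E * _)%E]/(c0%:E * P setT)%E probability_setT mule1.
rewrite !EFinD !EFinM.
by rewrite leeD2l // leeD2l // lee_wpmul2l // lee_fin.
Qed.
End moment_bound.


(** * Semidefiniteness of matrices a I + c 1 1^T *)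

Section compound_symmetry.
Context {R : realType} (n : nat).

Lemma quad_form (A : 'M[R]_n) (x : 'cV[R]_n) :
  (x^T *m A *m x) 0 0 = \sum_s \sum_t x s 0 * A s t * x t 0.
Proof.
rewrite !mxE exchange_big /=; apply: eq_bigr => t _.
by rewrite !mxE mulr_suml; apply: eq_bigr => s _; rewrite !mxE.
Qed.

(** The quadratic form is a q + c l^2, with q the sum of squares and l the sum of the entries of x.
    For c < 0, Cauchy-Schwarz bounds it below by (a + n c) q. *)
Lemma psdmx_compound_symmetry (a c : R) (A : 'M[R]_n) :
  0 <= a -> 0 <= a + n%:R * c -> (forall s t, A s t = a *+ (s == t) + c) ->
  psdmx A.
Proof.
move=> a0 ac0 AE; split.
  by apply/matrixP => s t; rewrite mxE !AE eq_sym.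
move=> x; rewrite quad_form.
have -> : \sum_s \sum_t x s 0 * A s t * x t 0
    = a * \sum_s x s 0 ^+ 2 + c * (\sum_s x s 0) ^+ 2.
  rewrite mulr_sumr expr2 mulr_suml mulr_sumr -big_split /=.
  apply: eq_bigr => s _.
  have AxE t : x s 0 * A s t * x t 0 =
      (a * x s 0 ^+ 2) *+ (t == s) + c * x s 0 * x t 0.
    by rewrite AE eq_sym; case: eqP => [->|_]; rewrite ?mulr1n ?mulr0n; ring.
  rewrite (eq_bigr _ (fun t _ => AxE t)) big_split /= -mulr_sumr -mulrA.
  congr (_ + _).
  by rewrite (bigD1 s) //= eqxx big1 ?addr0 // => t /negbTE ->.
set q := \sum_s x s 0 ^+ 2; set l := \sum_s x s 0.
have [c0|c0] := leP 0 c.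
  rewrite addr_ge0 // mulr_ge0 // ?sqr_ge0 // sumr_ge0 // => s _.
  by rewrite sqr_ge0.
have q0 : 0 <= q by rewrite sumr_ge0 // => s _; rewrite sqr_ge0.
have CS : l ^+ 2 <= n%:R * q.
  (* Lagrange's identity: the squared differences sum to 2 (n q - l^2). *)
  have : 0 <= \sum_s \sum_t (x s 0 - x t 0) ^+ 2.
    by apply: sumr_ge0 => s _; apply: sumr_ge0 => t _; rewrite sqr_ge0.
  have -> : \sum_s \sum_t (x s 0 - x t 0) ^+ 2 = 2 * (n%:R * q - l ^+ 2).
    transitivity (\sum_s (n%:R * x s 0 ^+ 2 + q - 2 * x s 0 * l)).
      apply: eq_bigr => s _.
      rewrite (eq_bigr (fun t =>
          (x s 0 ^+ 2 + x t 0 ^+ 2) - 2 * x s 0 * x t 0)).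
        rewrite sumrB big_split /= sumr_const card_ord -mulr_sumr.
        by rewrite -[_ *+ n]mulr_natl.
      by move=> t _; ring.
    rewrite sumrB big_split /= sumr_const card_ord -mulr_sumr -mulr_suml.
    by rewrite -mulr_sumr -/q -/l -[_ *+ n]mulr_natl; ring.
  lra.
have : 0 <= (a + n%:R * c) * q by rewrite mulr_ge0.
nra.
Qed.

End compound_symmetry.

(** * The event, the orthant and the AM-GM inequality *)

Lemma measurable_prod_ge (R : realType) n (gamma : R) :
  measurable [set x : n.-tuple R | gamma <= \prod_(t < n) tnth x t].
Proof.
rewrite -[X in measurable X]setTI; apply: measurable_fun_le => //.
by apply: measurable_prod => t _; exact: measurable_tnth.
Qed.

Lemma measurable_nonneg_orthant (R : realType) n :
  measurable (@nonneg_orthant R n).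
Proof.
have -> : @nonneg_orthant R n =
    \bigcap_(t in [set: 'I_n]) [set x : n.-tuple R | 0 <= tnth x t].
  by apply/seteqP; split => x x0 t => [_|]; exact: x0.
apply: fin_bigcap_measurable => // t _.
rewrite -[X in measurable X]setTI; apply: measurable_fun_le => //.
exact: measurable_tnth.
Qed.

Lemma AGM_root (R : realType) n (g : R) (x : n.-tuple R) :
  (0 < n)%N -> 0 <= g ->
  @nonneg_orthant R n x -> g ^+ n <= \prod_(t < n) tnth x t ->
  g <= (\sum_(t < n) tnth x t) / n%:R.
Proof.
move=> n0 g0 x0 gx.
have := leif_AGM (A := predT) (E := tnth x) (fun t _ => x0 t).
rewrite cardT size_enum_ord => -[+ _].
move=> /(le_trans gx); rewrite ler_pXn2r // nnegrE.
by rewrite divr_ge0 // sumr_ge0 // => t _; exact: x0.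
Qed.

(** * Moments of the sum of the coordinates *)

Section sum_moments.
Context {R : realType} {n : nat} {P : probability (n.-tuple R) R}.
Implicit Types (m : 'cV[R]_n) (x : n.-tuple R).

Lemma integrable_sum_tnth m : has_mean P m ->
  P.-integrable setT (fun x => (\sum_(t < n) tnth x t)%:E).
Proof.
move=> Pm; under eq_fun do rewrite -sumEFin.
by apply: integrable_sum => // t _; case: (Pm t).
Qed.

Lemma integral_sum_tnth m : has_mean P m ->
  (\int[P]_x (\sum_(t < n) tnth x t)%:E = (\sum_t m t 0)%:E)%E.
Proof.
move=> Pm; under eq_integral do rewrite -sumEFin.
rewrite integral_sum // => [|t]; last by case: (Pm t).
rewrite -sumEFin; apply: eq_bigr => t _.
by case: (Pm t) => _; rewrite unlock.
Qed.

Lemma sqr_sum_tnth x :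
  (\sum_(t < n) tnth x t) ^+ 2
  = \sum_(st : 'I_n * 'I_n) tnth x st.1 * tnth x st.2.
Proof.
rewrite expr2 mulr_suml -(pair_bigA _ (fun s t => tnth x s * tnth x t)) /=.
by apply: eq_bigr => s _; rewrite mulr_sumr.
Qed.

Lemma integrable_sqr_sum_tnth : has_second_moments P ->
  P.-integrable setT (fun x => ((\sum_(t < n) tnth x t) ^+ 2)%:E).
Proof.
move=> P2; under eq_fun do rewrite sqr_sum_tnth -sumEFin.
by apply: integrable_sum => // -[s t] _; exact: P2.
Qed.

Lemma integral_sqr_sum_tnth : has_second_moments P ->
  (\int[P]_x ((\sum_(t < n) tnth x t) ^+ 2)%:E
   = (\sum_s \sum_t second_moment_mx P s t)%:E)%E.
Proof.
move=> P2; under eq_integral do rewrite sqr_sum_tnth -sumEFin.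
rewrite integral_sum //.
rewrite pair_bigA -sumEFin; apply: eq_bigr => -[s t] _ /=.
by rewrite mxE unlock fineK //; apply: integrable_fin_num => //; exact: P2.
Qed.

(** The sum of all entries is the quadratic form at the all-ones vector. *)
Lemma loewner_le_sum (A B : 'M[R]_n) : loewner_le A B ->
  \sum_s \sum_t A s t <= \sum_s \sum_t B s t.
Proof.
move=> [_ /(_ (const_mx 1))]; rewrite quad_form => BA.
rewrite -subr_ge0 -sumrB; apply: (le_trans BA); apply: ler_sum => s _.
rewrite -sumrB; apply: ler_sum => t _.
by rewrite !mxE mul1r mulr1.
Qed.

End sum_moments.

(** * The prescribed mean and second-moment bound *)

Lemma mean_vecE (R : realType) n (mu : R) t : mean_vec n mu t 0 = mu.
Proof. by rewrite !mxE mulr1. Qed.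

Lemma moment_boundE (R : realType) n (mu sigma rho : R) s t :
  (covariance_mx n sigma rho + mean_vec n mu *m (mean_vec n mu)^T) s t
  = ((1 - rho) * sigma ^+ 2) *+ (s == t) + (rho * sigma ^+ 2 + mu ^+ 2).
Proof.
rewrite !mxE !big_ord1 !mxE !mulr1 -addrA -expr2.
by rewrite mulr_natr.
Qed.

(** This is where theta arises: each row of the covariance matrix sums to sigma^2 (1 - rho + n
    rho). *)
Lemma sum_moment_bound (R : realType) n (mu sigma rho : R) :
  \sum_s \sum_t
    (covariance_mx n sigma rho + mean_vec n mu *m (mean_vec n mu)^T) s t
  = n%:R * (sigma ^+ 2 * (1 + (n%:R - 1) * rho)) + n%:R ^+ 2 * mu ^+ 2.
Proof.
transitivity (\sum_(s < n) ((1 - rho) * sigma ^+ 2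
                            + n%:R * (rho * sigma ^+ 2 + mu ^+ 2))).
  apply: eq_bigr => s _; under eq_bigr do rewrite moment_boundE.
  rewrite big_split /= sumr_const card_ord -[_ *+ n]mulr_natl; congr (_ + _).
  rewrite (bigD1 s) //= eqxx big1 ?addr0 // => t.
  by rewrite eq_sym => /negbTE ->.
by rewrite sumr_const card_ord -[_ *+ n]mulr_natl; ring.
Qed.

(** * Upper bounds over the ambiguity set and their attainment *)

Section ambiguity.
Context {R : realType} {n : nat} (mu sigma rho : R).
Hypothesis n0 : (0 < n)%N.
Let theta := 1 + (n%:R - 1) * rho.
Let amb := ambiguity_set (mean_vec n mu) (covariance_mx n sigma rho).

Lemma ambiguity_prob_le (P : probability (n.-tuple R) R) (g c0 c1 c2 : R) :
  amb P -> 0 <= g -> 0 <= c2 ->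
  (forall y, 0 <= y -> 0 <= c0 + (c1 * y + c2 * y ^+ 2)) ->
  (forall y, g <= y -> 1 <= c0 + (c1 * y + c2 * y ^+ 2)) ->
  (P [set x | (g ^+ n <= \prod_(t < n) tnth x t)%R]
   <= (c0 + (c1 * mu + c2 * (mu ^+ 2 + sigma ^+ 2 * theta / n%:R)))%:E)%E.
Proof.
move=> [PO Pm P2 PS] g0 c20 q0 q1.
have nn0 : n%:R != 0 :> R by rewrite pnatr_eq0 -lt0n.
(* The known moments are those of the sum, not of the mean, so [c1] and [c2] are rescaled by n and
   n^2. *)
have -> : c0 + (c1 * mu + c2 * (mu ^+ 2 + sigma ^+ 2 * theta / n%:R))
  = c0 + (c1 / n%:R * (n%:R * mu) + c2 / n%:R ^+ 2 *
     (n%:R * (sigma ^+ 2 * theta) + n%:R ^+ 2 * mu ^+ 2)) by field.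
apply: (@prob_le_moments _ _ _ P (fun x => \sum_(t < n) tnth x t)
          (@nonneg_orthant R n)) => //.
- exact: integrable_sum_tnth Pm.
- exact: integrable_sqr_sum_tnth P2.
- rewrite (integral_sum_tnth Pm); congr (_%:E).
  under eq_bigr do rewrite mean_vecE.
  by rewrite sumr_const card_ord mulr_natl.
- rewrite integral_sqr_sum_tnth // lee_fin -sum_moment_bound.
  exact: loewner_le_sum.
- exact: measurable_nonneg_orthant.
- exact: measurable_prod_ge.
- by rewrite divr_ge0 // sqr_ge0.
- move=> x x0.
  rewrite (_ : c0 + _ = c0 + (c1 * ((\sum_(t < n) tnth x t) / n%:R) +
     c2 * ((\sum_(t < n) tnth x t) / n%:R) ^+ 2)); last by field.
  rewrite indicE; case: (boolP (_ \in _)) => [/set_mem /= gx|_] /=.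
    by apply: q1; exact: AGM_root.
  by apply: q0; rewrite divr_ge0 // sumr_ge0 // => t _; exact: x0.
Qed.

(** All coordinates coincide under this law, so its second-moment matrix is constant and the gap to
    the bound has the form a I + c 1 1^T. Its eigenvalue on the all-ones vector is n times the slack
    in the second-moment hypothesis. *)
Lemma two_point_ambiguity (p a b : R) :
  0 <= p <= 1 -> 0 <= a -> 0 <= b -> rho <= 1 ->
  p * a + (1 - p) * b = mu ->
  p * a ^+ 2 + (1 - p) * b ^+ 2 <= mu ^+ 2 + sigma ^+ 2 * theta / n%:R ->
  amb (two_point p [tuple a | _ < n] [tuple b | _ < n]).
Proof.
move=> p01 a0 b0 rho1 m1 m2.
have nn0 : 0 < n%:R :> R by rewrite ltr0n.
have mM s t : measurable_fun setT (fun x : n.-tuple R => tnth x s * tnth x t).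
  by apply: measurable_funM; exact: measurable_tnth.
have M s t : (\int[two_point p [tuple a | _ < n] [tuple b | _ < n]]_x
    (tnth x s * tnth x t)%:E = (p * a ^+ 2 + (1 - p) * b ^+ 2)%:E)%E.
  by rewrite two_point_integral // !tnth_mktuple ?mulr_ge0 // !expr2.
split.
- rewrite two_point_measure //; last exact: measurable_nonneg_orthant.
  rewrite !indicE !mem_set /= ?mulr1 ?subrKC //.
  - by move=> t; rewrite tnth_mktuple.
  - by move=> t; rewrite tnth_mktuple.
- move=> t; split.
    by apply: two_point_integrable; exact: measurable_tnth.
  rewrite unlock two_point_integral //; last 3 first.
  - exact: measurable_tnth.
  - by rewrite tnth_mktuple.
  - by rewrite tnth_mktuple.
  by rewrite !tnth_mktuple mean_vecE m1.
- by move=> s t; apply: two_point_integrable.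
- apply: (@psdmx_compound_symmetry _ _ ((1 - rho) * sigma ^+ 2)
    (rho * sigma ^+ 2 + mu ^+ 2 - (p * a ^+ 2 + (1 - p) * b ^+ 2))).
  + by rewrite mulr_ge0 ?sqr_ge0 // subr_ge0.
  + suff -> : (1 - rho) * sigma ^+ 2 + n%:R *
        (rho * sigma ^+ 2 + mu ^+ 2 - (p * a ^+ 2 + (1 - p) * b ^+ 2))
      = n%:R * (mu ^+ 2 + sigma ^+ 2 * theta / n%:R
                - (p * a ^+ 2 + (1 - p) * b ^+ 2)).
      by rewrite mulr_ge0 // subr_ge0.
    by rewrite /theta; field; rewrite gt_eqF.
  + move=> s t; transitivity ((covariance_mx n sigma rho
        + mean_vec n mu *m (mean_vec n mu)^T) s t
        - second_moment_mx (two_point p [tuple a | _ < n] [tuple b | _ < n]) s t).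
      by rewrite !mxE.
    rewrite moment_boundE -[LHS]addrA; congr (_ + (_ - _)).
    by rewrite mxE unlock M.
Qed.

(** Optimality certificate: the quadratic [q] bounds every probability by [p], and the law with mass
    [p] at [a] and the rest at [b] reaches it. *)
Lemma sup_prob_prod_geE (g p a b c0 c1 c2 : R) :
  let q y := c0 + (c1 * y + c2 * y ^+ 2) in
  0 <= p <= 1 -> 0 <= g <= a -> 0 <= b -> rho <= 1 ->
  p * a + (1 - p) * b = mu ->
  p * a ^+ 2 + (1 - p) * b ^+ 2 <= mu ^+ 2 + sigma ^+ 2 * theta / n%:R ->
  0 <= c2 -> (forall y, 0 <= y -> 0 <= q y) -> (forall y, g <= y -> 1 <= q y) ->
  c0 + (c1 * mu + c2 * (mu ^+ 2 + sigma ^+ 2 * theta / n%:R)) = p ->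
  sup_prob_prod_ge (mean_vec n mu) (covariance_mx n sigma rho) (g ^+ n) = p%:E.
Proof.
move=> q p01 /andP[g0 ga] b0 rho1 m1 m2 c20 q0 q1 Ep.
have a0 := le_trans g0 ga.
apply/eqP; rewrite eq_le.
apply/andP; split.
  by apply: ge_ereal_sup => _ [P aP <-]; rewrite -Ep; exact: ambiguity_prob_le.
apply: ereal_sup_ge; eexists.
  exists (two_point p [tuple a | _ < n] [tuple b | _ < n]) => //.
  exact: two_point_ambiguity.
rewrite two_point_measure //; last exact: measurable_prod_ge.
rewrite lee_fin indicE mem_set /= ?mulr1.
  (* The atom at [b] may lie in the event too; its nonnegative contribution does no harm to the
     lower bound. *)
  by rewrite lerDl mulr_ge0 // subr_ge0; case/andP: p01.
under eq_bigr do rewrite tnth_mktuple.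
by rewrite prodr_const card_ord lerXn2r ?nnegrE.
Qed.

End ambiguity.

(** * The three regimes of the threshold *)

Theorem theorem5p2 (R : realType) (T : nat) (mu sigma rho gamma : R)
    (hT : (2 <= T)%N) (hmu : 0 < mu) (hsigma : 0 < sigma)
    (hrho_lb : - (T%:R - 1)^-1 < rho) (hrho_ub : rho < 1)
    (hmurho : 0 < mu ^+ 2 + rho * sigma ^+ 2) (hgamma : 0 < gamma) :
  let theta := 1 + (T%:R - 1) * rho in
  let R' := sup_prob_prod_ge (mean_vec T mu) (covariance_mx T sigma rho) in
  let gamma_star := (mu + sigma ^+ 2 * theta / (T%:R * mu)) ^+ T in
  0 < theta /\
  [/\ gamma <= mu ^+ T -> R' gamma = 1%E,
      mu ^+ T < gamma < gamma_star ->
        R' gamma = (mu * gamma `^ (- T%:R^-1))%:E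
    & gamma_star <= gamma ->
        R' gamma = (sigma ^+ 2 * theta /
          (sigma ^+ 2 * theta
            + T%:R * (mu - gamma `^ T%:R^-1) ^+ 2))%:E].
Proof.
move=> theta R' gamma_star.
have T0 : (0 < T)%N by apply: leq_trans hT.
have T1 : 0 < T%:R - 1 :> R by rewrite subr_gt0 ltr1n.
have Tr : 0 < T%:R :> R by rewrite ltr0n.
have theta0 : 0 < theta.
  move: hrho_lb; rewrite -(ltr_pM2l T1) mulrN mulfV ?gt_eqF // /theta; lra.
split=> //.
rewrite powRN.
set g := gamma `^ T%:R^-1.
have g0 : 0 < g by exact: powR_gt0.
have gE : gamma = g ^+ T.
  by rewrite -powR_mulrn ?ltW // /g -powRrM mulVf ?gt_eqF // powRr1 // ltW.
have le_root (a b : R) : 0 <= a -> 0 <= b -> (a ^+ T <= b ^+ T) = (a <= b).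
  by move=> a0 b0; rewrite ler_pXn2r.
have lt_root (a b : R) : 0 <= a -> 0 <= b -> (a ^+ T < b ^+ T) = (a < b).
  by move=> a0 b0; rewrite ltr_pXn2r.
(* The largest variance of the sample mean that the constraints allow. *)
pose s := sigma ^+ 2 * theta / T%:R.
have s0 : 0 < s by rewrite divr_gt0 // mulr_gt0 // exprn_gt0.
have sE : sigma ^+ 2 * theta = T%:R * s by rewrite /s; field; rewrite gt_eqF.
have -> : gamma_star = (mu + s / mu) ^+ T.
  by rewrite /gamma_star /s; congr (_ ^+ T); field; rewrite !gt_eqF.
have star0 : 0 <= mu + s / mu by rewrite ltW // addr_gt0 // divr_gt0.
rewrite /R' gE le_root ?lt_root ?le_root ?(ltW g0) ?(ltW hmu) // sE.
have mu0 : 0 <= mu by exact: ltW.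
have rho1 : rho <= 1 by exact: ltW.
split=> [g_le | /andP[mu_lt g_lt] | g_ge].
(* Point mass at mu, with the constant quadratic 1. *)
- apply: (@sup_prob_prod_geE _ _ _ _ _ T0 g 1 mu mu 1 0 0) => //.
  + by rewrite ler01 lexx.
  + by rewrite ltW.
  + by ring.
  + by rewrite -/theta -/s; lra.
  + by move=> y _; lra.
  + by move=> y _; lra.
  + by ring.
(* Markov: atoms g and 0, where mean mu forces mass mu / g at g. The second moment mu g is
   admissible because g < mu + s / mu. *)
- apply: (@sup_prob_prod_geE _ _ _ _ _ T0 g (mu / g) g 0 0 g^-1 0) => //.
  + by rewrite divr_ge0 ?(ltW g0) //= ler_pdivrMr // mul1r ltW.
  + by rewrite lexx ltW.
  + by field; rewrite gt_eqF.
  + rewrite -/theta -/s.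
    have -> : mu / g * g ^+ 2 + (1 - mu / g) * 0 ^+ 2 = mu * g.
      by field; rewrite gt_eqF.
    have : mu * g <= mu * (mu + s / mu) by rewrite ler_pM2l // ltW.
    suff -> : mu * (mu + s / mu) = mu ^+ 2 + s by [].
    by field; rewrite gt_eqF.
  + by move=> y y0; rewrite add0r mul0r addr0 mulr_ge0 // invr_ge0 ltW.
  + by move=> y gy; rewrite add0r mul0r addr0 mulrC ler_pdivlMr // mul1r.
  + by rewrite mul0r addr0 add0r mulrC.
- have s_d : s / mu <= g - mu by lra.
  have d0 : 0 < g - mu by apply: lt_le_trans s_d; rewrite divr_gt0.
  have sd0 : 0 < s + (g - mu) ^+ 2 by rewrite addr_gt0 // exprn_gt0.
  pose b := mu - s / (g - mu).
  have gb0 : 0 < g - b.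
    have : 0 < s / (g - mu) by rewrite divr_gt0.
    rewrite /b; lra.
  have b0 : 0 <= b.
    by rewrite subr_ge0 ler_pdivrMr // mulrC -ler_pdivrMr.
  have dn0 : g - mu != 0 by rewrite gt_eqF.
  have sdn0 : s + (g - mu) ^+ 2 != 0 by rewrite gt_eqF.
  have gbn0 : g - b != 0 by rewrite gt_eqF.
  have Tn0 : T%:R != 0 :> R by rewrite gt_eqF.
  have qE y : b ^+ 2 / (g - b) ^+ 2 + (- 2 * b / (g - b) ^+ 2 * y
      + ((g - b) ^+ 2)^-1 * y ^+ 2) = ((y - b) / (g - b)) ^+ 2 by field.
  have -> : T%:R * s / (T%:R * s + T%:R * (mu - g) ^+ 2)
      = s / (s + (g - mu) ^+ 2).
    have -> : T%:R * s + T%:R * (mu - g) ^+ 2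
        = T%:R * (s + (g - mu) ^+ 2) by ring.
    by field; rewrite Tn0 sdn0.
  (* Cantelli: the coefficients expand ((y - b) / (g - b))^2, which is 0 at b and 1 at g. The mass
     at g is the one giving atoms g and b mean mu; the variance is then exactly s. *)
  apply: (@sup_prob_prod_geE _ _ _ _ _ T0 g (s / (s + (g - mu) ^+ 2)) g b
    (b ^+ 2 / (g - b) ^+ 2) (- 2 * b / (g - b) ^+ 2) ((g - b) ^+ 2)^-1) => //.
  + rewrite divr_ge0 ?(ltW s0) ?(ltW sd0) //= ler_pdivrMr // mul1r.
    by rewrite lerDl sqr_ge0.
  + by rewrite lexx ltW.
  + by rewrite /b; field; rewrite dn0.
  + rewrite -/theta -/s le_eqVlt; apply/orP; left; apply/eqP.
    by rewrite /b; field; rewrite dn0.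
  + by rewrite invr_ge0 sqr_ge0.
  + by move=> y _; rewrite qE sqr_ge0.
  + by move=> y gy; rewrite qE exprn_ege1 // ler_pdivlMr // mul1r lerD2r.
  + rewrite -/theta -/s.
    (* The expected quadratic, by splitting the second moment about b into squared bias plus
       variance. *)
    have -> : b ^+ 2 / (g - b) ^+ 2 + (- 2 * b / (g - b) ^+ 2 * mu
        + ((g - b) ^+ 2)^-1 * (mu ^+ 2 + s))
        = ((mu - b) ^+ 2 + s) / (g - b) ^+ 2.
      by field.
    have -> : g - b = (s + (g - mu) ^+ 2) / (g - mu) by rewrite /b; field.
    have -> : mu - b = s / (g - mu) by rewrite /b; ring.
    by field; rewrite dn0 sdn0.
Qed.
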